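(* Let $G$ be a computable subgroup of $S_\infty$. If the actions of $G$ are non-isolated, then $R^{ce}_G$ is $\Sigma^0_3$-universal, i.e., every $\Sigma^0_3$ equivalence relation on $\omega$ is computably reducible to $R^{ce}_G$.
   Context: $(W_e)_{e\in\omega}$ is a standard uniform enumeration of the c.e.\ subsets of $\omega$. A computable subgroup of $S_\infty$ is a computable group acting computably by permutations on $\omega$, with induced representation $\pi:G\to S_\omega$. For $Y\subseteq\omega$, $\mathrm{Stab}(Y)=\{g\in G:\forall x\in Y\ (g(x)=x)\}$; the actions of $G$ are isolated if there is a finite $F\subseteq\omega$ with $\mathrm{Stab}(F)=\ker(\pi)$, and non-isolated otherwise. $i\,R^{ce}_G\,j\iff(\exists\gamma\in G)(W_i=\{\gamma(x):x\in W_j\})$. $E$ is computably reducible to $F$ if there is a computable $f$ with $x\,E\,y\iff f(x)\,F\,f(y)$. *)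

(* Defs.v *)
From Stdlib Require Import Arith Lia List RelationClasses.
From Stdlib Require Cantor.

Definition cpair (x y : nat) : nat := Cantor.to_nat (x, y).

(* Codes for the unary partial recursive functions; functions of several
   arguments are handled through the Cantor pairing. *)
Inductive code : Set :=
| cZero : code
| cSucc : code
| cFst : code
| cSnd : code
| cPair : code -> code -> code
| cComp : code -> code -> code
| cPrec : code -> code -> code
| cMu : code -> code.

(* Graph of the function h defined by
   h(a, 0) = f(a) and h(a, n+1) = g(<a, <n, h(a, n)>>). *)
Fixpoint prec_graph (f g : nat -> nat -> Prop) (a n y : nat) : Prop :=
  match n with
  | 0 => f a y
  | S m => exists z, prec_graph f g a m z /\ g (cpair a (cpair m z)) y
  end.

(* [eval c x y] : the partial function coded by [c] converges on [x] with
   value [y]. *)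
Fixpoint eval (c : code) (x y : nat) : Prop :=
  match c with
  | cZero => y = 0
  | cSucc => y = S x
  | cFst => y = fst (Cantor.of_nat x)
  | cSnd => y = snd (Cantor.of_nat x)
  | cPair c1 c2 => exists u v, eval c1 x u /\ eval c2 x v /\ y = cpair u v
  | cComp c1 c2 => exists z, eval c2 x z /\ eval c1 z y
  | cPrec c1 c2 =>
      prec_graph (eval c1) (eval c2)
        (fst (Cantor.of_nat x)) (snd (Cantor.of_nat x)) y
  | cMu c1 =>
      eval c1 (cpair x y) 0 /\
      forall m, m < y -> exists k, eval c1 (cpair x m) (S k)
  end.

Fixpoint encode (c : code) : nat :=
  match c with
  | cZero => 0
  | cSucc => 1
  | cFst => 2
  | cSnd => 3
  | cPair c1 c2 => 4 + 4 * cpair (encode c1) (encode c2)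
  | cComp c1 c2 => 5 + 4 * cpair (encode c1) (encode c2)
  | cPrec c1 c2 => 6 + 4 * cpair (encode c1) (encode c2)
  | cMu c1 => 7 + 4 * encode c1
  end.

Definition phi (e x y : nat) : Prop := exists c, encode c = e /\ eval c x y.

(* W_e is the domain of phi_e. *)
Definition W (e x : nat) : Prop := exists y, phi e x y.

(* The next lemmas check that [encode] is a bijective Goedel numbering and that
   every phi_e is single-valued. *)

Lemma cpair_inj x y x' y' : cpair x y = cpair x' y' -> x = x' /\ y = y'.
Proof.
  unfold cpair; intros H.
  apply (f_equal Cantor.of_nat) in H.
  rewrite !Cantor.cancel_of_to in H; injection H; auto.
Qed.

Lemma encode_inj c d : encode c = encode d -> c = d.
Proof.
  revert d; induction c; destruct d; cbn [encode]; intros H;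
    try lia; try reflexivity;
    try (assert (E : cpair (encode c1) (encode c2) =
                     cpair (encode d1) (encode d2)) by lia;
         apply cpair_inj in E; destruct E; f_equal; auto).
  f_equal; apply IHc; lia.
Qed.

Lemma encode_surj e : exists c, encode c = e.
Proof.
  induction e as [e IH] using lt_wf_ind.
  destruct (lt_dec e 4) as [h|h].
  { destruct e as [|[|[|[|e]]]]; [exists cZero|exists cSucc|exists cFst|exists cSnd|lia];
      reflexivity. }
  pose (q := (e - 4) / 4); pose (r := (e - 4) mod 4).
  assert (Hq : e - 4 = 4 * q + r) by apply Nat.div_mod_eq.
  assert (Hr : r < 4) by (apply Nat.mod_upper_bound; lia).
  clearbody q r.
  destruct (IH q) as [c Hc]; [lia|].
  destruct (Cantor.of_nat q) as [a b] eqn:Eab.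
  assert (Hp : cpair a b = q) by (unfold cpair; rewrite <- Eab; apply Cantor.cancel_to_of).
  assert (Hle : b + a <= q) by (rewrite <- Hp; apply Cantor.to_nat_non_decreasing).
  destruct (IH a) as [ca Ha]; [lia|]; destruct (IH b) as [cb Hb]; [lia|].
  assert (Hr' : r = 0 \/ r = 1 \/ r = 2 \/ r = 3) by lia.
  destruct Hr' as [H|[H|[H|H]]]; subst r;
    [exists (cPair ca cb)|exists (cComp ca cb)|exists (cPrec ca cb)|exists (cMu c)];
    cbn [encode]; rewrite ?Ha, ?Hb, ?Hp, ?Hc; lia.
Qed.

Lemma eval_functional c x y y' : eval c x y -> eval c x y' -> y = y'.
Proof.
  revert x y y'; induction c; cbn [eval]; intros x y y' H H'; try congruence.
  - destruct H as (u & v & Hu & Hv & ->), H' as (u' & v' & Hu' & Hv' & ->).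
    f_equal; eauto.
  - destruct H as (z & Hz & Hy), H' as (z' & Hz' & Hy').
    rewrite (IHc2 _ _ _ Hz Hz') in Hy; eauto.
  - revert y y' H H'.
    generalize (fst (Cantor.of_nat x)) as a; generalize (snd (Cantor.of_nat x)) as n.
    induction n as [|n IH]; cbn [prec_graph]; intros a y y' H H'; eauto.
    destruct H as (z & Hz & Hy), H' as (z' & Hz' & Hy').
    rewrite (IH _ _ _ Hz Hz') in Hy; eauto.
  - destruct H as [H0 Hlt], H' as [H0' Hlt'].
    destruct (lt_eq_lt_dec y y') as [[h|h]|h]; auto; exfalso.
    + destruct (Hlt' _ h) as [k Hk]; discriminate (IHc _ _ _ H0 Hk).
    + destruct (Hlt _ h) as [k Hk]; discriminate (IHc _ _ _ H0' Hk).
Qed.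

Lemma phi_functional e x y y' : phi e x y -> phi e x y' -> y = y'.
Proof.
  intros (c & Hc & H) (c' & Hc' & H').
  assert (c = c') as <- by (apply encode_inj; congruence).
  eapply eval_functional; eauto.
Qed.

Definition computable (f : nat -> nat) : Prop :=
  exists c, forall x, eval c x (f x).

Definition computable2 (f : nat -> nat -> nat) : Prop :=
  computable (fun n => f (fst (Cantor.of_nat n)) (snd (Cantor.of_nat n))).

Definition computable_set (A : nat -> Prop) : Prop :=
  exists f, computable f /\
    forall x, (A x -> f x = 1) /\ (~ A x -> f x = 0).

Definition Sigma03 (E : nat -> nat -> Prop) : Prop :=
  exists A, computable_set A /\
    forall x y, E x y <->
      exists a, forall b, exists c, A (cpair (cpair x y) (cpair a (cpair b c))).

Definition computably_reducible (E F : nat -> nat -> Prop) : Prop :=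
  exists f, computable f /\ forall x y, E x y <-> F (f x) (f y).

Definition Sigma03_universal (R : nat -> nat -> Prop) : Prop :=
  forall E : nat -> nat -> Prop,
    Equivalence E -> Sigma03 E -> computably_reducible E R.

(* A group whose domain is a computable subset of omega.  [mul] is a total
   computable function whose values outside the domain are irrelevant;
   computability of the inverse follows by search. *)
Record computable_group : Type := {
  dom : nat -> Prop;
  mul : nat -> nat -> nat;
  one : nat;
  dom_computable : computable_set dom;
  mul_computable : computable2 mul;
  one_dom : dom one;
  mul_dom : forall g h, dom g -> dom h -> dom (mul g h);
  mul_assoc : forall g h k, dom g -> dom h -> dom k ->
    mul g (mul h k) = mul (mul g h) k;
  mul_one_l : forall g, dom g -> mul one g = g;
  mul_one_r : forall g, dom g -> mul g one = g;
  mul_inv : forall g, dom g ->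
    exists h, dom h /\ mul h g = one /\ mul g h = one
}.

(* The action need not be faithful.  Each group element acts as a permutation
   of omega by the action laws. *)
Record computable_subgroup_Sinf : Type := {
  grp :> computable_group;
  act : nat -> nat -> nat;
  act_computable : computable2 act;
  act_one : forall x, act (one grp) x = x;
  act_mul : forall g h x, dom grp g -> dom grp h ->
    act (mul grp g h) x = act g (act h x)
}.

Definition Stab (G : computable_subgroup_Sinf) (Y : nat -> Prop) (g : nat) : Prop :=
  dom G g /\ forall x, Y x -> act G g x = x.

Definition ker (G : computable_subgroup_Sinf) (g : nat) : Prop :=
  dom G g /\ forall x, act G g x = x.

Definition isolated (G : computable_subgroup_Sinf) : Prop :=
  exists F : list nat, forall g, Stab G (fun x => In x F) g <-> ker G g.

Definition non_isolated (G : computable_subgroup_Sinf) : Prop := ~ isolated G.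

Definition Rce (G : computable_subgroup_Sinf) (i j : nat) : Prop :=
  exists g, dom G g /\
    forall y, W i y <-> exists x, W j x /\ y = act G g x.

(* Main.v *)
From Stdlib Require Import Arith Lia List Bool RelationClasses ClassicalEpsilon.
From Stdlib Require Cantor.
Require Import Defs.
Import ListNotations.

(** Write the relation as [x E y <-> exists i, forall b, exists z, A(x,y,i,b,z)].  For a set
    [S] of numbers below [n], say that the cut [(n, S)] is crossed to depth [k] when [A] relates,
    via some [i < n] and for all [b < k], two numbers below [n] separated by [S].  If [x E y],
    every cut with [n] large that separates [x] and [y] is crossed to all depths; otherwise the
    [E]-class of [x] below [n] gives a cut that separates them and is crossed only to a bounded
    depth.  Giving each triple [t = (n, S, k)] the bit [x in S], and calling it live when [k] is
    the exact depth to which the cut is crossed (a limit-computable condition), we get: [x E y]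
    iff the bits of [x] and [y] differ at only finitely many live [t].

    Non-isolation supplies group elements [h_t] fixing larger and larger finite sets, and the
    limit set [V_x] is the image of a set [C] under the infinite product of the [h_t] over the
    live [t] whose bit at [x] is 1.  A finite difference of bits only changes a finite initial
    factor of the product, hence moves [V_x] by an element of [G].  Each [h_t] and a finite part
    of [C] are chosen so that [h_t C <> u^-1 g v C] for all [g <= t] and all partial products
    [u, v] of the earlier elements, so an infinite difference defeats every [g] in [G].  The
    construction is a finite-injury one: when the guess about some [t] changes, the later factors
    are discarded and [C] is replaced by the union of its images under all their partial
    products, which keeps the stages of [V_x] increasing. *)

(** * Partial recursive codes *)

Lemma of_nat_cpair x y : Cantor.of_nat (cpair x y) = (x, y).
Proof. apply Cantor.cancel_of_to. Qed.

Lemma cpair_of_nat n : cpair (fst (Cantor.of_nat n)) (snd (Cantor.of_nat n)) = n.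
Proof. unfold cpair; rewrite <- surjective_pairing; apply Cantor.cancel_to_of. Qed.

Lemma cpair_ge_l x y : x <= cpair x y.
Proof. pose proof (Cantor.to_nat_non_decreasing x y); unfold cpair; lia. Qed.

Lemma cpair_ge_r x y : y <= cpair x y.
Proof. pose proof (Cantor.to_nat_non_decreasing x y); unfold cpair; lia. Qed.

Lemma eval_fst x y : eval cFst (cpair x y) x.
Proof. simpl; now rewrite of_nat_cpair. Qed.

Lemma eval_snd x y : eval cSnd (cpair x y) y.
Proof. simpl; now rewrite of_nat_cpair. Qed.

Lemma eval_comp c d x y z : eval d x y -> eval c y z -> eval (cComp c d) x z.
Proof. intros; simpl; eauto. Qed.

Lemma eval_pair c d x y z : eval c x y -> eval d x z -> eval (cPair c d) x (cpair y z).
Proof. intros; simpl; eauto 6. Qed.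

Lemma eval_prec c d a n (h : nat -> nat) :
  eval c a (h 0) ->
  (forall m, m < n -> eval d (cpair a (cpair m (h m))) (h (S m))) ->
  eval (cPrec c d) (cpair a n) (h n).
Proof.
  intros base_case step_case; cbn [eval]; rewrite of_nat_cpair; cbn [fst snd].
  induction n as [|n IH]; cbn [prec_graph]; [assumption|].
  exists (h n); split; [apply IH; auto|apply step_case; lia].
Qed.

Definition cId : code := cPair cFst cSnd.

Lemma eval_id x : eval cId x x.
Proof. rewrite <- (cpair_of_nat x) at 2; apply eval_pair; reflexivity. Qed.

Fixpoint cConst (n : nat) : code :=
  match n with 0 => cZero | S m => cComp cSucc (cConst m) end.

Lemma eval_const n x : eval (cConst n) x n.
Proof. induction n as [|n IH]; [reflexivity|]; simpl; eauto. Qed.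

Definition cSign : code := cComp (cPrec cZero (cConst 1)) (cPair cZero cId).

Lemma eval_sign n : eval cSign n (match n with 0 => 0 | S _ => 1 end).
Proof.
  eapply eval_comp; [eapply eval_pair; [reflexivity|apply eval_id]|].
  apply (eval_prec _ _ _ n (fun n => match n with 0 => 0 | S _ => 1 end)); [reflexivity|].
  intros; apply eval_const.
Qed.

(* Recursing over the sign of [n] evaluates [d] only when [n] is positive. *)
Definition cIf (cn c d : code) : code :=
  cComp (cPrec c (cComp d cFst)) (cPair cId (cComp cSign cn)).

Lemma eval_if cn c d a n y :
  eval cn a n ->
  (n = 0 -> eval c a y) ->
  (n <> 0 -> eval d a y /\ exists z, eval c a z) ->
  eval (cIf cn c d) a y.
Proof.
  intros test zero_branch positive_branch.
  eapply eval_comp.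
  { eapply eval_pair; [apply eval_id|eapply eval_comp; [exact test|apply eval_sign]]. }
  destruct n as [|n].
  - apply (eval_prec _ _ a 0 (fun _ => y)); [auto|lia].
  - destruct positive_branch as [eval_d [z eval_c]]; [lia|].
    apply (eval_prec _ _ a 1 (fun n => match n with 0 => z | S _ => y end)); [auto|].
    intros m m_lt; eapply eval_comp; [apply eval_fst|].
    replace m with 0 by lia; assumption.
Qed.

Lemma eval_mu c (p : nat -> bool) x n :
  (forall m, eval c (cpair x m) (Nat.b2n (negb (p m)))) ->
  eval (cMu c) x n <-> p n = true /\ forall m, m < n -> p m = false.
Proof.
  intros c_tests; cbn [eval]; split; intros [at_n below].
  - split.
    + generalize (eval_functional _ _ _ _ at_n (c_tests n)); destruct (p n); easy.
    + intros m m_lt; destruct (below m m_lt) as [k at_m].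
      generalize (eval_functional _ _ _ _ at_m (c_tests m)); destruct (p m); easy.
  - split; [generalize (c_tests n); now rewrite at_n|].
    intros m m_lt; exists 0; generalize (c_tests m); now rewrite below.
Qed.

Definition cSpecialize (c : code) (x : nat) : code := cComp c (cPair (cConst x) cId).

Lemma eval_specialize c x y z : eval (cSpecialize c x) y z <-> eval c (cpair x y) z.
Proof.
  assert (eval_input : eval (cPair (cConst x) cId) y (cpair x y))
    by (apply eval_pair; [apply eval_const|apply eval_id]).
  split.
  - intros (u & eval_u & eval_z).
    now rewrite (eval_functional _ _ _ _ eval_u eval_input) in eval_z.
  - now apply eval_comp.
Qed.

(** * Computability of functions on encoded types *)

Class Encodable (A : Type) := enc : A -> nat.
#[export] Instance enc_nat : Encodable nat := fun n => n.
#[export] Instance enc_bool : Encodable bool := Nat.b2n.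
#[export] Instance enc_prod {A B} `{Encodable A} `{Encodable B} : Encodable (A * B) :=
  fun p => cpair (enc (fst p)) (enc (snd p)).
#[export] Instance enc_list {A} `{Encodable A} : Encodable (list A) :=
  fix enc_list l := match l with
                    | [] => 0
                    | x :: l' => S (cpair (enc x) (enc_list l'))
                    end.

(* The code may diverge on numbers that encode no element of [A]. *)
Definition effective {A B} `{Encodable A} `{Encodable B} (f : A -> B) : Prop :=
  exists c, forall a, eval c (enc a) (enc (f a)).

Definition effective2 {A B C} `{Encodable A} `{Encodable B} `{Encodable C}
    (f : A -> B -> C) : Prop :=
  effective (fun p : A * B => f (fst p) (snd p)).

Definition effective3 {A B C D} `{Encodable A} `{Encodable B} `{Encodable C} `{Encodable D}
    (f : A -> B -> C -> D) : Prop :=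
  effective (fun p : A * (B * C) => f (fst p) (fst (snd p)) (snd (snd p))).

Section Combinators.
Context {Γ : Type} `{Encodable Γ}.

Lemma effective_ext {B} `{Encodable B} (f g : Γ -> B) :
  (forall a, f a = g a) -> effective f -> effective g.
Proof. intros f_eq_g [c c_f]; exists c; intros a; rewrite <- f_eq_g; auto. Qed.

Lemma effective_id : effective (fun a : Γ => a).
Proof. exists cId; intros; apply eval_id. Qed.

Lemma effective_const {B} `{Encodable B} (b : B) : effective (fun _ : Γ => b).
Proof. exists (cConst (enc b)); intros; apply eval_const. Qed.

Lemma effective_pair {B C} `{Encodable B} `{Encodable C} (f : Γ -> B) (g : Γ -> C) :
  effective f -> effective g -> effective (fun a => (f a, g a)).
Proof. intros [c c_f] [d d_g]; exists (cPair c d); intros a; apply eval_pair; auto. Qed.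

Lemma effective_comp {B C} `{Encodable B} `{Encodable C} (g : B -> C) (f : Γ -> B) :
  effective g -> effective f -> effective (fun a => g (f a)).
Proof. intros [d d_g] [c c_f]; exists (cComp d c); intros a; eapply eval_comp; eauto. Qed.

Lemma effective_comp2 {A B C} `{Encodable A} `{Encodable B} `{Encodable C}
    (g : A -> B -> C) (f1 : Γ -> A) (f2 : Γ -> B) :
  effective2 g -> effective f1 -> effective f2 -> effective (fun a => g (f1 a) (f2 a)).
Proof.
  intros eff_g eff_f1 eff_f2.
  exact (effective_comp _ _ eff_g (effective_pair _ _ eff_f1 eff_f2)).
Qed.

Lemma effective_comp3 {A B C D}
    `{Encodable A} `{Encodable B} `{Encodable C} `{Encodable D}
    (g : A -> B -> C -> D) (f1 : Γ -> A) (f2 : Γ -> B) (f3 : Γ -> C) :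
  effective3 g -> effective f1 -> effective f2 -> effective f3 ->
  effective (fun a => g (f1 a) (f2 a) (f3 a)).
Proof.
  intros eff_g eff_f1 eff_f2 eff_f3.
  exact (effective_comp _ _ eff_g
    (effective_pair _ _ eff_f1 (effective_pair _ _ eff_f2 eff_f3))).
Qed.

Lemma effective_if {B} `{Encodable B} (b : Γ -> bool) (f g : Γ -> B) :
  effective b -> effective f -> effective g -> effective (fun a => if b a then f a else g a).
Proof.
  intros [cb c_b] [cf c_f] [cg c_g]; exists (cIf cb cg cf); intros a.
  eapply eval_if; [apply c_b|..]; destruct (b a); cbn; try lia; eauto.
Qed.

Lemma effective_nat_rect {B} `{Encodable B} (n : Γ -> nat) (i : Γ -> B) (f : Γ -> nat -> B -> B) :
  effective n -> effective i -> effective3 f ->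
  effective (fun a => nat_rect (fun _ => B) (i a) (f a) (n a)).
Proof.
  intros [cn c_n] [ci c_i] [cf c_f].
  exists (cComp (cPrec ci cf) (cPair cId cn)); intros a.
  eapply eval_comp; [eapply eval_pair; [apply eval_id|apply c_n]|].
  apply (eval_prec _ _ _ _ (fun m => enc (nat_rect (fun _ => B) (i a) (f a) m))); [apply c_i|].
  intros m _; exact (c_f (a, (m, nat_rect (fun _ => B) (i a) (f a) m))).
Qed.
End Combinators.

Section Constructors.
Context {A B : Type} `{Encodable A} `{Encodable B}.

Lemma effective_fst : effective (@fst A B).
Proof. exists cFst; intros; apply eval_fst. Qed.

Lemma effective_snd : effective (@snd A B).
Proof. exists cSnd; intros; apply eval_snd. Qed.

Lemma effective_cons : effective2 (@cons A).
Proof. exists (cComp cSucc cId); intros p; eapply eval_comp; [apply eval_id|reflexivity]. Qed.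
End Constructors.

Lemma effective_S : effective S.
Proof. now exists cSucc. Qed.

Lemma effective_cpair : effective2 cpair.
Proof. exists cId; intros; apply eval_id. Qed.

Lemma effective_of_nat : effective Cantor.of_nat.
Proof.
  exists cId; intros n.
  replace (enc (Cantor.of_nat n)) with n; [apply eval_id|symmetry; apply cpair_of_nat].
Qed.

Lemma effective_pred : effective pred.
Proof.
  apply (effective_ext (fun n => nat_rect (fun _ => nat) 0 (fun m _ => m) n)).
  { now intros []. }
  apply (effective_nat_rect (fun n => n) (fun _ => 0) (fun _ m _ => m));
    [apply effective_id|apply effective_const|].
  apply (effective_comp fst snd); [apply effective_fst|apply effective_snd].
Qed.

Lemma effective_list_match {Γ A B} `{Encodable Γ} `{Encodable A} `{Encodable B}
    (l : Γ -> list A) (f : Γ -> B) (g : Γ -> A -> list A -> B) :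
  effective l -> effective f -> effective3 g ->
  effective (fun a => match l a with [] => f a | x :: t => g a x t end).
Proof.
  intros [cl c_l] [cf c_f] [cg c_g].
  destruct effective_pred as [cp c_pred].
  exists (cIf cl cf (cComp cg (cPair cId (cComp cp cl)))); intros a.
  eapply eval_if; [apply c_l|..]; intros code_l.
  - destruct (l a); [apply c_f|discriminate].
  - split; [|eauto].
    eapply eval_comp.
    { eapply eval_pair; [apply eval_id|eapply eval_comp; [apply c_l|apply c_pred]]. }
    destruct (l a) as [|x t]; [contradiction code_l; reflexivity|].
    exact (c_g (a, (x, t))).
Qed.

Create HintDb effective discriminated.
#[export] Hint Resolve effective_fst effective_snd effective_cons effective_S effective_cpair
  effective_of_nat effective_pred : effective.

Ltac effective_atom := solve [auto 2 with effective nocore].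

(* Descends along the head symbols of a function body.  Higher-order operations have their own
   rules, recorded in [effective_operator]; any other head must be a hint or a hypothesis. *)
Ltac effective_operator := fail.
Ltac effectivity :=
  autounfold with effective; unfold effective2, effective3; cbv beta zeta;
  first
  [ effective_atom
  | lazymatch goal with
    | |- effective (fun _ => ?c) => apply (effective_const c)
    | |- effective (fun x => x) => apply effective_id
    | |- effective (fun x => (@?f x, @?g x)) => apply (effective_pair f g)
    | |- effective (fun x => if @?b x then @?f x else @?g x) => apply (effective_if b f g)
    | |- effective (fun x => nat_rect _ (@?i x) (@?f x) (@?n x)) =>
        apply (effective_nat_rect n i f)
    | |- effective (fun x => match @?l x with [] => @?f x | y :: t => @?g x y t end) =>
        apply (effective_list_match l f g)
    end; effectivity
  | effective_operator; effectivity
  | match goal with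
    | |- effective (fun x => ?g (@?f x)) => apply (effective_comp g f); [effective_atom|]
    | |- effective (fun x => ?g (@?f x) (@?h x)) =>
        apply (effective_comp2 g f h); [effective_atom|..]
    | |- effective (fun x => ?g (@?f x) (@?h x) (@?k x)) =>
        apply (effective_comp3 g f h k); [effective_atom|..]
    end; effectivity ].

Section Folds.
Context {Γ A B : Type} `{Encodable Γ} `{Encodable A} `{Encodable B}.

Lemma length_le_enc (l : list A) : length l <= enc l.
Proof.
  induction l as [|x l IH]; [reflexivity|].
  change (enc (x :: l)) with (S (cpair (enc x) (enc l))).
  pose proof (cpair_ge_r (enc x) (enc l)); simpl; lia.
Qed.

Definition fold_step (f : B -> A -> B) (p : list A * B) : list A * B :=
  match fst p with [] => p | x :: t => (t, f (snd p) x) end.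

Lemma iter_fold_step f n l b :
  length l <= n -> Nat.iter n (fold_step f) (l, b) = ([], fold_left f l b).
Proof.
  revert l b; induction n as [|n IH]; intros [|x l] b length_le; simpl in length_le; try lia;
    [reflexivity|..]; rewrite Nat.iter_succ_r.
  - apply (IH []); simpl; lia.
  - apply (IH l (f b x)); lia.
Qed.

Lemma effective_fold_left (f : Γ -> B -> A -> B) (l : Γ -> list A) (i : Γ -> B) :
  effective3 f -> effective l -> effective i ->
  effective (fun a => fold_left (f a) (l a) (i a)).
Proof.
  intros eff_f eff_l eff_i.
  apply (effective_ext (fun a => snd (Nat.iter (enc (l a)) (fold_step (f a)) (l a, i a)))).
  { intros a; rewrite iter_fold_step; [reflexivity|apply length_le_enc]. }
  assert (eff_enc_l : effective (fun a => enc (l a))) by exact eff_l.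
  unfold Nat.iter, fold_step; effectivity.
Qed.
End Folds.

Lemma effective_rev {A} `{Encodable A} : effective (@rev A).
Proof.
  apply (effective_ext (fun l => fold_left (fun r x => x :: r) l [])).
  { intros l; rewrite <- (fold_left_rev_right cons).
    induction (rev l); simpl; congruence. }
  apply (effective_fold_left (fun _ r x => x :: r)); effectivity.
Qed.

Lemma effective_fold_right {Γ A B} `{Encodable Γ} `{Encodable A} `{Encodable B}
    (f : Γ -> A -> B -> B) (l : Γ -> list A) (i : Γ -> B) :
  effective3 f -> effective l -> effective i ->
  effective (fun a => fold_right (f a) (i a) (l a)).
Proof.
  intros eff_f eff_l eff_i.
  apply (effective_ext (fun a => fold_left (fun b x => f a x b) (rev (l a)) (i a))).
  { intros a; now rewrite <- (fold_left_rev_right (f a)), rev_involutive. }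
  pose proof (@effective_rev A).
  apply (effective_fold_left (fun a b x => f a x b)); effectivity.
Qed.

Lemma effective_app {A} `{Encodable A} : effective2 (@app A).
Proof.
  apply (effective_ext (fun p => fold_right cons (snd p) (fst p))).
  { intros [k l]; cbn [fst snd]; induction k; simpl; congruence. }
  apply (effective_fold_right (fun _ x r => x :: r)); effectivity.
Qed.
#[export] Hint Resolve effective_app : effective.

Section ListOperators.
Context {Γ A B : Type} `{Encodable Γ} `{Encodable A} `{Encodable B}.

Lemma effective_map (f : Γ -> A -> B) (l : Γ -> list A) :
  effective2 f -> effective l -> effective (fun a => map (f a) (l a)).
Proof.
  intros eff_f eff_l.
  apply (effective_ext (fun a => fold_right (fun x r => f a x :: r) [] (l a))).
  { intros a; induction (l a); simpl; congruence. }
  apply (effective_fold_right (fun a x r => f a x :: r)); effectivity.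
Qed.

Lemma effective_flat_map (f : Γ -> A -> list B) (l : Γ -> list A) :
  effective2 f -> effective l -> effective (fun a => flat_map (f a) (l a)).
Proof.
  intros eff_f eff_l.
  apply (effective_ext (fun a => fold_right (fun x r => f a x ++ r) [] (l a))).
  { intros a; induction (l a); simpl; congruence. }
  apply (effective_fold_right (fun a x r => f a x ++ r)); effectivity.
Qed.

Lemma effective_existsb (f : Γ -> A -> bool) (l : Γ -> list A) :
  effective2 f -> effective l -> effective (fun a => existsb (f a) (l a)).
Proof.
  intros eff_f eff_l.
  apply (effective_ext (fun a => fold_right (fun x r => if f a x then true else r) false (l a))).
  { intros a; induction (l a) as [|x r IH]; simpl; [reflexivity|now rewrite IH]. }
  apply (effective_fold_right (fun a x r => if f a x then true else r)); effectivity.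
Qed.

Lemma effective_forallb (f : Γ -> A -> bool) (l : Γ -> list A) :
  effective2 f -> effective l -> effective (fun a => forallb (f a) (l a)).
Proof.
  intros eff_f eff_l.
  apply (effective_ext (fun a => fold_right (fun x r => if f a x then r else false) true (l a))).
  { intros a; induction (l a) as [|x r IH]; simpl; [reflexivity|now rewrite IH]. }
  apply (effective_fold_right (fun a x r => if f a x then r else false)); effectivity.
Qed.
End ListOperators.

Ltac effective_operator ::=
  lazymatch goal with
  | |- effective (fun x => fold_left (@?f x) (@?l x) (@?i x)) => apply (effective_fold_left f l i)
  | |- effective (fun x => fold_right (@?f x) (@?i x) (@?l x)) => apply (effective_fold_right f l i)
  | |- effective (fun x => map (@?f x) (@?l x)) => apply (effective_map f l)
  | |- effective (fun x => flat_map (@?f x) (@?l x)) => apply (effective_flat_map f l)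
  | |- effective (fun x => existsb (@?f x) (@?l x)) => apply (effective_existsb f l)
  | |- effective (fun x => forallb (@?f x) (@?l x)) => apply (effective_forallb f l)
  end.

Lemma effective_negb : effective negb.
Proof. unfold negb; effectivity. Qed.

Lemma effective_andb : effective2 andb.
Proof. unfold andb; effectivity. Qed.

Lemma effective_orb : effective2 orb.
Proof. unfold orb; effectivity. Qed.

Lemma effective_xorb : effective2 xorb.
Proof. unfold xorb; effectivity. Qed.

Lemma effective_eqbool : effective2 Bool.eqb.
Proof. unfold Bool.eqb; effectivity. Qed.
#[export] Hint Resolve effective_negb effective_andb effective_orb effective_xorb effective_eqbool
  : effective.

Lemma effective_add : effective2 Nat.add.
Proof.
  apply (effective_ext (fun p => nat_rect (fun _ => nat) (snd p) (fun _ => S) (fst p))).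
  { intros [m n]; induction m; simpl in *; congruence. }
  effectivity.
Qed.

Lemma effective_sub : effective2 Nat.sub.
Proof.
  apply (effective_ext (fun p => nat_rect (fun _ => nat) (fst p) (fun _ => pred) (snd p))).
  { intros [m n]; induction n; simpl in *; lia. }
  effectivity.
Qed.
#[export] Hint Resolve effective_add effective_sub : effective.

Lemma effective_mul : effective2 Nat.mul.
Proof.
  apply (effective_ext (fun p => nat_rect (fun _ => nat) 0 (fun _ r => snd p + r) (fst p))).
  { intros [m n]; induction m; simpl in *; congruence. }
  effectivity.
Qed.

Lemma effective_eqb : effective2 Nat.eqb.
Proof.
  apply (effective_ext (fun p => nat_rect (fun _ => bool) true (fun _ _ => false)
                                   ((fst p - snd p) + (snd p - fst p)))).
  { intros [m n]; cbn [fst snd]; destruct (Nat.eqb_spec m n) as [->|m_neq_n].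
    - now rewrite Nat.sub_diag.
    - destruct (m - n + (n - m)) eqn:distance; [lia|reflexivity]. }
  effectivity.
Qed.
#[export] Hint Resolve effective_mul effective_eqb : effective.

Lemma effective_length {A} `{Encodable A} : effective (@length A).
Proof.
  apply (effective_ext (fun l => fold_right (fun _ => S) 0 l)).
  { intros l; induction l; simpl; congruence. }
  effectivity.
Qed.

Lemma effective_skipn {A} `{Encodable A} : effective2 (@skipn A).
Proof.
  apply (effective_ext (fun p => nat_rect (fun _ => list A) (snd p)
                         (fun _ r => match r with [] => [] | _ :: t => t end) (fst p))).
  { intros [n l]; cbn [fst snd]; induction n as [|n IH]; cbn [nat_rect]; [reflexivity|]; rewrite IH.
    change (S n) with (1 + n); rewrite <- skipn_skipn.
    now destruct (skipn n l). }
  effectivity.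
Qed.
#[export] Hint Resolve effective_length effective_skipn : effective.

Lemma effective_nth {A} `{Encodable A} : effective3 (@nth A).
Proof.
  apply (effective_ext (fun p => match skipn (fst p) (fst (snd p)) with
                                 | [] => snd (snd p)
                                 | x :: _ => x
                                 end)).
  { intros (n & l & d); cbn [fst snd]; rewrite <- (Nat.add_0_r n) at 2; rewrite <- nth_skipn.
    now destruct (skipn n l). }
  effectivity.
Qed.

Lemma effective_seq : effective2 seq.
Proof.
  apply (effective_ext (fun p => nat_rect (fun _ => list nat) []
                                   (fun n r => r ++ [fst p + n]) (snd p))).
  { intros [m n]; cbn [fst snd]; induction n as [|n IH]; [reflexivity|].
    rewrite seq_S; simpl; congruence. }
  effectivity.
Qed.
#[export] Hint Resolve effective_nth effective_seq : effective.

Lemma map_app_eq_seq {A} (f : A -> nat) K L m :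
  map f (K ++ L) = seq m (length (K ++ L)) <->
  map f K = seq m (length K) /\ map f L = seq (m + length K) (length L).
Proof.
  revert m; induction K as [|x K IH]; intros m; simpl; [rewrite Nat.add_0_r; tauto|].
  rewrite <- Nat.add_succ_comm; split.
  - intros [= -> tail]; apply IH in tail as [-> ->]; auto.
  - intros [[= -> head] tail]; f_equal; apply IH; auto.
Qed.

Definition mem (x : nat) (l : list nat) : bool := existsb (Nat.eqb x) l.

Lemma mem_In x l : mem x l = true <-> In x l.
Proof.
  unfold mem; rewrite existsb_exists; split.
  - intros (y & y_in & x_eq_y); apply Nat.eqb_eq in x_eq_y; congruence.
  - intros x_in; exists x; now rewrite Nat.eqb_refl.
Qed.

Lemma effective_mem : effective2 mem.
Proof. unfold mem; effectivity. Qed.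
#[export] Hint Resolve effective_mem : effective.

Lemma effective_of_computable_set A : computable_set A ->
  exists a : nat -> bool, effective a /\ forall x, a x = true <-> A x.
Proof.
  intros (f & eff_f & f_spec); exists (fun x => f x =? 1); split.
  - change (effective f) in eff_f; effectivity.
  - intros x; rewrite Nat.eqb_eq; split; [|apply f_spec].
    intros fx_1; apply NNPP; intros not_A; apply f_spec in not_A; lia.
Qed.

Lemma effective_of_computable2 f : computable2 f -> effective2 f.
Proof.
  intros [c c_f]; exists c; intros [x y].
  generalize (c_f (cpair x y)); rewrite of_nat_cpair; auto.
Qed.

(** * Unbounded search and the s-m-n theorem *)

Lemma exists_least (P : nat -> Prop) :
  (exists n, P n) -> exists n, P n /\ forall m, m < n -> ~ P m.
Proof.
  intros ex_P.
  destruct (dec_inh_nat_subset_has_unique_least_element P) as (n & [P_n n_least] & _);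
    [intros n; apply classic|assumption|].
  exists n; split; [assumption|]; intros m m_lt P_m; apply n_least in P_m; lia.
Qed.

Lemma exists_least_true (p : nat -> bool) :
  (exists n, p n = true) -> exists n, p n = true /\ forall m, m < n -> p m = false.
Proof.
  intros ex_p; destruct (exists_least _ ex_p) as (n & p_n & n_least).
  exists n; split; [assumption|]; intros m m_lt; now apply not_true_is_false, n_least.
Qed.

(* Unspecified when [p] is nowhere true. *)
Definition least (p : nat -> bool) : nat :=
  epsilon (inhabits 0) (fun n => p n = true /\ forall m, m < n -> p m = false).

Lemma least_spec p : (exists n, p n = true) ->
  p (least p) = true /\ forall m, m < least p -> p m = false.
Proof.
  intros ex_p; unfold least.
  apply (epsilon_spec (inhabits 0) _ (exists_least_true p ex_p)).
Qed.

Lemma effective_least {Γ} `{Encodable Γ} (p : Γ -> nat -> bool) :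
  effective2 p -> (forall a, exists n, p a n = true) -> effective (fun a => least (p a)).
Proof.
  intros eff_p ex_p.
  assert (eff_negb : effective2 (fun a n => negb (p a n))) by effectivity.
  destruct eff_negb as [c c_negb]; exists (cMu c); intros a.
  apply (eval_mu c (p a)); [exact (fun m => c_negb (a, m))|].
  now apply least_spec.
Qed.

Lemma effective_encode_const : effective (fun n => encode (cConst n)).
Proof.
  apply (effective_ext (fun n => nat_rect (fun _ => nat) 0 (fun _ e => 5 + 4 * cpair 1 e) n)).
  { intros n; induction n as [|n IH]; [reflexivity|].
    cbn [nat_rect cConst encode]; now rewrite IH. }
  effectivity.
Qed.
#[export] Hint Resolve effective_encode_const : effective.

Lemma effective_encode_specialize c : effective (fun x => encode (cSpecialize c x)).
Proof.
  change (effective (fun x =>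
    5 + 4 * cpair (encode c) (4 + 4 * cpair ((fun n => encode (cConst n)) x) (encode cId)))).
  generalize (encode c), (encode cId); intros e e'; effectivity.
Qed.

Lemma ce_sets_index (p : nat -> nat -> nat -> bool) :
  effective3 p ->
  exists f, computable f /\ forall x y, W (f x) y <-> exists s, p x y s = true.
Proof.
  intros eff_p.
  assert (eff_negb : effective2 (fun xy s => negb (p (fst xy) (snd xy) s))) by effectivity.
  destruct eff_negb as [c c_negb].
  exists (fun x => encode (cSpecialize (cMu c) x)); split; [apply effective_encode_specialize|].
  intros x y.
  assert (halts : forall s, eval (cSpecialize (cMu c) x) y s <->
    p x y s = true /\ forall m, m < s -> p x y m = false).
  { intros s; rewrite eval_specialize; apply eval_mu; exact (fun m => c_negb (x, y, m)). }
  split.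
  - intros (s & d & d_index & halts_s); apply encode_inj in d_index; subst d.
    apply halts in halts_s as [p_s _]; eauto.
  - intros ex_p; destruct (exists_least_true _ ex_p) as (s & least_s).
    exists s, (cSpecialize (cMu c) x); split; [reflexivity|now apply halts].
Qed.

(** * Total operations of a computable permutation group *)

Section TotalOperations.
Variable G : computable_subgroup_Sinf.

(* Numbers outside the domain are read as the identity, so that all operations become total. *)
Definition elem (g : nat) : nat :=
  if excluded_middle_informative (dom G g) then g else one G.

Definition perm (g x : nat) : nat := act G (elem g) x.

Definition gmul (g h : nat) : nat := mul G (elem g) (elem h).

Definition ginv (g : nat) : nat :=
  least (fun h => (gmul h g =? one G) && (gmul g h =? one G)).

Lemma elem_dom g : dom G (elem g).
Proof. unfold elem; destruct excluded_middle_informative; [assumption|apply one_dom]. Qed.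

Lemma elem_id g : dom G g -> elem g = g.
Proof. intros g_dom; unfold elem; now destruct excluded_middle_informative. Qed.

Lemma perm_one x : perm (one G) x = x.
Proof. unfold perm; rewrite elem_id by apply one_dom; apply act_one. Qed.

Lemma perm_gmul g h x : perm (gmul g h) x = perm g (perm h x).
Proof.
  unfold perm, gmul; rewrite elem_id by (apply mul_dom; apply elem_dom).
  apply act_mul; apply elem_dom.
Qed.

Lemma inverse_exists g :
  exists h, (gmul h g =? one G) && (gmul g h =? one G) = true.
Proof.
  destruct (mul_inv G (elem g) (elem_dom g)) as (h & h_dom & left_inv & right_inv).
  exists h; unfold gmul; now rewrite (elem_id h), left_inv, right_inv, Nat.eqb_refl.
Qed.

Lemma gmul_ginv g : gmul (ginv g) g = one G /\ gmul g (ginv g) = one G.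
Proof.
  destruct (least_spec _ (inverse_exists g)) as [is_inverse _].
  now apply andb_true_iff in is_inverse as [?%Nat.eqb_eq ?%Nat.eqb_eq].
Qed.

Lemma perm_ginv_l g x : perm (ginv g) (perm g x) = x.
Proof. rewrite <- perm_gmul, (proj1 (gmul_ginv g)); apply perm_one. Qed.

Lemma perm_ginv_r g x : perm g (perm (ginv g) x) = x.
Proof. rewrite <- perm_gmul, (proj2 (gmul_ginv g)); apply perm_one. Qed.

Lemma perm_inj g x y : perm g x = perm g y -> x = y.
Proof. intros gx_gy; now rewrite <- (perm_ginv_l g x), gx_gy, perm_ginv_l. Qed.

Lemma effective_elem : effective elem.
Proof.
  destruct (effective_of_computable_set _ (dom_computable G)) as (in_dom & eff_in_dom & in_dom_iff).
  apply (effective_ext (fun g => if in_dom g then g else one G)); [|effectivity].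
  intros g; unfold elem; specialize (in_dom_iff g).
  destruct excluded_middle_informative, (in_dom g); intuition congruence.
Qed.
#[local] Hint Resolve effective_elem : effective.

Lemma effective_perm : effective2 perm.
Proof.
  pose proof (effective_of_computable2 _ (act_computable G)); unfold perm; effectivity.
Qed.

Lemma effective_gmul : effective2 gmul.
Proof.
  pose proof (effective_of_computable2 _ (mul_computable G)); unfold gmul; effectivity.
Qed.
#[local] Hint Resolve effective_perm effective_gmul : effective.

Lemma effective_ginv : effective ginv.
Proof.
  apply (effective_least (fun g h => (gmul h g =? one G) && (gmul g h =? one G)));
    [effectivity|exact inverse_exists].
Qed.
#[local] Hint Resolve effective_ginv : effective.

Definition carries (g : nat) (A B : nat -> Prop) : Prop := forall x, B (perm g x) <-> A x.

Lemma carries_ginv g A B : carries g A B -> carries (ginv g) B A.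
Proof. intros g_AB x; rewrite <- (g_AB (perm (ginv g) x)), perm_ginv_r; reflexivity. Qed.

Lemma Rce_iff_carries i j : Rce G i j <-> exists g, carries g (W j) (W i).
Proof.
  split.
  - intros (g & g_dom & image); exists g; intros x; rewrite image; unfold perm.
    rewrite (elem_id g g_dom); split; [|eauto].
    intros (y & y_in & gx_gy); replace x with y; [assumption|].
    apply (perm_inj g); unfold perm; now rewrite elem_id.
  - intros (g & g_ji); exists (elem g); split; [apply elem_dom|]; intros y; split.
    + intros y_in; exists (perm (ginv g) y); split.
      * now rewrite <- (g_ji (perm (ginv g) y)), perm_ginv_r.
      * symmetry; apply perm_ginv_r.
    + intros (x & x_in & ->); now apply g_ji.
Qed.

Definition fixes (F : list nat) (g : nat) : Prop := forall x, In x F -> perm g x = x.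

Lemma fixes_one F : fixes F (one G).
Proof. intros x _; apply perm_one. Qed.

Lemma fixes_gmul F g h : fixes F g -> fixes F h -> fixes F (gmul g h).
Proof. intros fix_g fix_h x x_in; now rewrite perm_gmul, fix_h, fix_g. Qed.

Lemma fixes_incl F F' g : incl F F' -> fixes F' g -> fixes F g.
Proof. intros F_F' fix_g x x_in; auto. Qed.

Lemma fixes_preimage F g x : fixes F g -> In (perm g x) F -> perm g x = x.
Proof. intros fix_g gx_in; apply (perm_inj g); auto. Qed.

Definition distinguishes (k d : nat) (F : list nat) (g q : nat) : bool :=
  forallb (fun x => perm g x =? x) F && (negb (mem q F) && negb (perm k (perm g q) =? perm d q)).

Lemma distinguishes_iff k d F g q : distinguishes k d F g q = true <->
  fixes F g /\ ~ In q F /\ perm k (perm g q) <> perm d q.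
Proof.
  unfold distinguishes.
  rewrite !andb_true_iff, forallb_forall, !negb_true_iff, Nat.eqb_neq, <- (mem_In q F).
  rewrite not_true_iff_false; unfold fixes; setoid_rewrite Nat.eqb_eq; reflexivity.
Qed.

Definition distinguisher (k d : nat) (F : list nat) : nat * nat :=
  Cantor.of_nat (least (fun n =>
    distinguishes k d F (fst (Cantor.of_nat n)) (snd (Cantor.of_nat n)))).

Hypothesis G_non_isolated : non_isolated G.

Lemma non_isolated_moves F : exists g q, fixes F g /\ perm g q <> q.
Proof.
  apply NNPP; intros no_move; apply G_non_isolated; exists F; intros g; split.
  - intros [g_dom fix_F]; split; [assumption|]; intros q; apply NNPP; intros g_moves.
    apply no_move; exists g, q; unfold fixes, perm; now rewrite elem_id.
  - intros [g_dom fix_all]; split; auto.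
Qed.

(* If [k] and [d] agree outside [F], then any [g] that fixes [F] and moves [q] works: [g q] is
   outside [F] as well, hence [k g q = d g q <> d q]. *)
Lemma distinguishing_pair_exists k d F : exists g q, distinguishes k d F g q = true.
Proof.
  setoid_rewrite distinguishes_iff.
  destruct (classic (exists q, ~ In q F /\ perm k q <> perm d q)) as [(q & q_out & k_d)|agree].
  { exists (one G), q; rewrite perm_one; auto using fixes_one. }
  destruct (non_isolated_moves F) as (g & q & fix_F & g_moves).
  assert (q_out : ~ In q F) by auto.
  assert (gq_out : ~ In (perm g q) F) by (intros gq_in; now apply g_moves, (fixes_preimage F)).
  exists g, q; repeat split; [assumption..|].
  intros kgq_dq; apply g_moves, (perm_inj d); rewrite <- kgq_dq.
  apply NNPP; intros differ; apply agree; exists (perm g q); auto.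
Qed.

Lemma distinguisher_exists k d F : exists n,
  distinguishes k d F (fst (Cantor.of_nat n)) (snd (Cantor.of_nat n)) = true.
Proof.
  destruct (distinguishing_pair_exists k d F) as (g & q & g_q).
  exists (cpair g q); now rewrite of_nat_cpair.
Qed.

Lemma distinguisher_spec k d F (w := distinguisher k d F) :
  fixes F (fst w) /\ ~ In (snd w) F /\ perm k (perm (fst w) (snd w)) <> perm d (snd w).
Proof. apply distinguishes_iff, (least_spec _ (distinguisher_exists k d F)). Qed.

Lemma effective_distinguisher : effective3 distinguisher.
Proof.
  apply (effective_comp Cantor.of_nat); [apply effective_of_nat|].
  apply (effective_least (fun (p : nat * (nat * list nat)) n =>
    distinguishes (fst p) (fst (snd p)) (snd (snd p))
      (fst (Cantor.of_nat n)) (snd (Cantor.of_nat n)))).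
  - unfold distinguishes; effectivity.
  - intros p; apply distinguisher_exists.
Qed.
End TotalOperations.

(** * A limit normal form for [Sigma03] equivalence relations *)

Definition bounded (P : nat -> Prop) : Prop := exists b, forall t, P t -> t < b.

Lemma bounded_incl (P Q : nat -> Prop) : (forall t, P t -> Q t) -> bounded Q -> bounded P.
Proof. intros P_Q [b Q_lt]; exists b; auto. Qed.

Lemma bounded_union (P : nat -> nat -> Prop) n :
  (forall i, i < n -> bounded (P i)) -> bounded (fun t => exists i, i < n /\ P i t).
Proof.
  induction n as [|n IH]; intros bounded_P; [exists 0; intros t (i & i_lt & _); lia|].
  destruct IH as [b b_bound]; [auto|].
  destruct (bounded_P n) as [c c_bound]; [auto|].
  exists (max b c); intros t (i & i_lt & P_t).
  destruct (Nat.eq_dec i n) as [->|i_neq]; [apply c_bound in P_t; lia|].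
  enough (t < b) by lia; apply b_bound; exists i; split; [lia|assumption].
Qed.

Lemma uniform_bound (P : nat -> nat -> Prop) n :
  (forall i, i < n -> exists z, P i z) -> exists s, forall i, i < n -> exists z, z < s /\ P i z.
Proof.
  induction n as [|n IH]; intros ex_P; [exists 0; lia|].
  destruct IH as [s s_bound]; [auto|].
  destruct (ex_P n) as [z P_z]; [auto|].
  exists (max s (S z)); intros i i_lt; destruct (Nat.eq_dec i n) as [->|i_neq].
  - exists z; split; [lia|assumption].
  - destruct (s_bound i) as (z' & z'_lt & P_z'); [lia|]; exists z'; split; [lia|assumption].
Qed.

Lemma bounded_unique (P : nat -> Prop) : (forall t u, P t -> P u -> t = u) -> bounded P.
Proof.
  intros unique; destruct (classic (exists t, P t)) as [[t P_t]|empty].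
  - exists (S t); intros u P_u; rewrite (unique u t); auto.
  - exists 0; intros t P_t; elim empty; eauto.
Qed.

Definition converges_to (f : nat -> bool) (b : bool) : Prop :=
  exists s0, forall s, s0 <= s -> f s = b.

Lemma converges_to_unique f b b' : converges_to f b -> converges_to f b' -> b = b'.
Proof.
  intros [s f_b] [s' f_b']; rewrite <- (f_b (max s s')), <- (f_b' (max s s')) by lia; reflexivity.
Qed.

Lemma converges_to_negb f b : converges_to f b -> converges_to (fun s => negb (f s)) (negb b).
Proof. intros [s f_b]; exists s; intros; f_equal; auto. Qed.

Lemma converges_to_andb f g b c :
  converges_to f b -> converges_to g c -> converges_to (fun s => f s && g s) (b && c).
Proof.
  intros [s f_b] [s' g_c]; exists (max s s'); intros; f_equal; [apply f_b|apply g_c]; lia.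
Qed.

Lemma monotone_converges_to (f : nat -> bool) :
  (forall s s', s <= s' -> f s = true -> f s' = true) ->
  exists b, converges_to f b /\ (b = true <-> exists s, f s = true).
Proof.
  intros f_mono; destruct (classic (exists s, f s = true)) as [[s f_s]|never].
  - exists true; split; [exists s; eauto|split; eauto].
  - exists false; split; [|split; [discriminate|contradiction]].
    exists 0; intros s _; apply not_true_is_false; eauto.
Qed.

Definition live (guess : nat -> nat -> bool) (t : nat) : Prop := converges_to (guess t) true.

Definition differ_live (bit guess : nat -> nat -> bool) (x y t : nat) : Prop :=
  live guess t /\ bit t x <> bit t y.

(* A pair [(n, S)] stands for the cut of the numbers below [n] into [S] and its complement. *)
Definition cut : Type := nat * list nat.

Definition separates (c : cut) (x y : nat) : Prop := mem x (snd c) <> mem y (snd c).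

Definition crossed_via (R : nat -> nat -> nat -> Prop) (c : cut) : Prop :=
  exists x, x < fst c /\ exists y, y < fst c /\ exists i, i < fst c /\ separates c x y /\ R x y i.

Lemma crossed_via_incl (Q R : nat -> nat -> nat -> Prop) c :
  (forall x y i, Q x y i -> R x y i) -> crossed_via Q c -> crossed_via R c.
Proof.
  intros Q_R (x & x_lt & y & y_lt & i & i_lt & sep & Q_xyi).
  exists x; split; [assumption|]; exists y; split; [assumption|]; exists i; auto.
Qed.

Fixpoint subsets (n : nat) : list (list nat) :=
  match n with
  | 0 => [[]]
  | S m => subsets m ++ map (cons m) (subsets m)
  end.

Lemma subsets_complete (P : nat -> Prop) n :
  exists l, In l (subsets n) /\ forall x, In x l <-> x < n /\ P x.
Proof.
  induction n as [|n (l & l_in & l_spec)]; [exists []; simpl; split; [auto|lia]|].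
  destruct (classic (P n)) as [P_n|not_P_n].
  - exists (n :: l); split; [apply in_or_app; auto using in_map|].
    intros x; simpl; rewrite l_spec; split; [intros [<-|[]]; auto|].
    intros [x_le P_x]; destruct (Nat.eq_dec x n); auto; right; split; auto; lia.
  - exists l; split; [apply in_or_app; auto|].
    intros x; rewrite l_spec; split; intros [x_le P_x]; split; auto.
    destruct (Nat.eq_dec x n) as [->|]; [contradiction|lia].
Qed.

Lemma effective_subsets : effective subsets.
Proof.
  apply (effective_ext (fun n =>
    nat_rect (fun _ => list (list nat)) [[]] (fun m P => P ++ map (cons m) P) n)).
  { intros n; induction n; simpl; congruence. }
  effectivity.
Qed.
#[export] Hint Resolve effective_subsets : effective.

(* The index [t] codes [((n, j), k)], where [j] numbers the subsets of [{0, ..., n-1}]; a [j] that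
   is too large denotes the empty set. *)
Definition cut_of (t : nat) : cut :=
  let nj := Cantor.of_nat (fst (Cantor.of_nat t)) in (fst nj, nth (snd nj) (subsets (fst nj)) []).

Definition depth_of (t : nat) : nat := snd (Cantor.of_nat t).

Lemma cut_of_cpair n j k : cut_of (cpair (cpair n j) k) = (n, nth j (subsets n) []).
Proof. unfold cut_of; rewrite of_nat_cpair; cbn [fst]; now rewrite of_nat_cpair. Qed.

Lemma depth_of_cpair m k : depth_of (cpair m k) = k.
Proof. unfold depth_of; now rewrite of_nat_cpair. Qed.

Definition cut_bit (t x : nat) : bool := mem x (snd (cut_of t)).

Lemma effective_cut_of : effective cut_of.
Proof. unfold cut_of; effectivity. Qed.

Lemma effective_depth_of : effective depth_of.
Proof. unfold depth_of; effectivity. Qed.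
#[export] Hint Resolve effective_cut_of effective_depth_of : effective.

Lemma effective_cut_bit : effective2 cut_bit.
Proof. unfold cut_bit; effectivity. Qed.

Lemma xorb_true_iff b c : xorb b c = true <-> b <> c.
Proof. destruct b, c; cbn; intuition congruence. Qed.

Lemma existsb_seq p n : existsb p (seq 0 n) = true <-> exists x, x < n /\ p x = true.
Proof.
  rewrite existsb_exists; split; intros (x & x_in & p_x); exists x; split; auto;
    [apply in_seq in x_in|apply in_seq]; lia.
Qed.

Lemma forallb_seq p n : forallb p (seq 0 n) = true <-> forall x, x < n -> p x = true.
Proof.
  rewrite forallb_forall; split; intros all_p x x_in; apply all_p;
    [apply in_seq|apply in_seq in x_in]; lia.
Qed.

Section CrossedCuts.
Variables (E : nat -> nat -> Prop) (a : nat -> bool).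

Definition verified (x y i b z : nat) : bool := a (cpair (cpair x y) (cpair i (cpair b z))).

Hypothesis effective_a : effective a.
Hypothesis E_equivalence : Equivalence E.
Hypothesis E_iff : forall x y, E x y <-> exists i, forall b, exists z, verified x y i b z = true.

Definition crossed (c : cut) (k : nat) : Prop :=
  k = 0 \/
  crossed_via (fun x y i => forall b, b < k -> exists z, verified x y i b z = true) c.

Definition crossed_by (s : nat) (c : cut) (k : nat) : bool :=
  (k =? 0) || existsb (fun x => existsb (fun y => existsb (fun i =>
    xorb (mem x (snd c)) (mem y (snd c)) &&
    forallb (fun b => existsb (verified x y i b) (seq 0 s)) (seq 0 k))
    (seq 0 (fst c))) (seq 0 (fst c))) (seq 0 (fst c)).

Definition live_by (t s : nat) : bool :=
  crossed_by s (cut_of t) (depth_of t) && negb (crossed_by s (cut_of t) (S (depth_of t))).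

Lemma effective_live_by : effective2 live_by.
Proof.
  assert (effective3 crossed_by) by (unfold crossed_by, verified; effectivity).
  unfold live_by; effectivity.
Qed.

Lemma crossed_by_iff s c k : crossed_by s c k = true <->
  k = 0 \/
  crossed_via (fun x y i => forall b, b < k -> exists z, z < s /\ verified x y i b z = true) c.
Proof.
  unfold crossed_by, crossed_via, separates; rewrite orb_true_iff, Nat.eqb_eq.
  repeat setoid_rewrite existsb_seq.
  setoid_rewrite andb_true_iff; setoid_rewrite forallb_seq; setoid_rewrite existsb_seq.
  setoid_rewrite xorb_true_iff; reflexivity.
Qed.

Lemma crossed_by_mono c k s s' :
  s <= s' -> crossed_by s c k = true -> crossed_by s' c k = true.
Proof.
  rewrite !crossed_by_iff; intros s_le [k_0|crossing]; [auto|right].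
  revert crossing; apply crossed_via_incl; intros x y i seen b b_lt.
  destruct (seen b b_lt) as (z & z_lt & z_ok); exists z; split; [lia|assumption].
Qed.

Lemma crossed_iff c k : crossed c k <-> exists s, crossed_by s c k = true.
Proof.
  setoid_rewrite crossed_by_iff; split.
  - intros [k_0|(x & x_lt & y & y_lt & i & i_lt & sep & seen)]; [exists 0; auto|].
    destruct (uniform_bound _ _ seen) as [s s_bound]; exists s; right.
    exists x; split; [assumption|]; exists y; split; [assumption|]; exists i; auto.
  - intros (s & [k_0|crossing]); [now left|right].
    revert crossing; apply crossed_via_incl; intros x y i seen b b_lt.
    destruct (seen b b_lt) as (z & _ & z_ok); eauto.
Qed.

Lemma crossed_by_converges c k :
  exists b, converges_to (fun s => crossed_by s c k) b /\ (b = true <-> crossed c k).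
Proof. setoid_rewrite crossed_iff; apply monotone_converges_to, crossed_by_mono. Qed.

Lemma live_by_converges t : exists b, converges_to (live_by t) b /\
  (b = true <-> crossed (cut_of t) (depth_of t) /\ ~ crossed (cut_of t) (S (depth_of t))).
Proof.
  destruct (crossed_by_converges (cut_of t) (depth_of t)) as (b & b_lim & b_iff).
  destruct (crossed_by_converges (cut_of t) (S (depth_of t))) as (b' & b'_lim & b'_iff).
  exists (b && negb b'); split.
  - now apply converges_to_andb, converges_to_negb.
  - now rewrite andb_true_iff, negb_true_iff, <- not_true_iff_false, b_iff, b'_iff.
Qed.

Lemma live_iff t : live live_by t <->
  crossed (cut_of t) (depth_of t) /\ ~ crossed (cut_of t) (S (depth_of t)).
Proof.
  destruct (live_by_converges t) as (b & b_lim & <-); split.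
  - now apply converges_to_unique.
  - now intros ->.
Qed.

Lemma crossed_antitone c k k' : k' <= k -> crossed c k -> crossed c k'.
Proof.
  intros k'_le [->|crossing]; [left; lia|right].
  revert crossing; apply crossed_via_incl; intros x y i seen b b_lt; apply seen; lia.
Qed.

Lemma related_crosses x y : E x y ->
  exists n, forall c k, n <= fst c -> separates c x y -> crossed c k.
Proof.
  intros [i seen]%E_iff; exists (S (x + y + i)); intros c k n_le sep; right.
  exists x; split; [lia|]; exists y; split; [lia|]; exists i; repeat split; auto; lia.
Qed.

(* Each of the finitely many triples [(x, y, i)] verifies only boundedly many consecutive [b]. *)
Lemma invariant_not_crossed c :
  (forall x y, x < fst c -> y < fst c -> E x y -> ~ separates c x y) ->
  exists k, ~ crossed c k.
Proof.
  intros invariant.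
  assert (bounded_depth : bounded (fun k =>
    crossed_via (fun x y i => forall b, b < k -> exists z, verified x y i b z = true) c)).
  { apply bounded_union; intros x x_lt; apply bounded_union; intros y y_lt.
    apply bounded_union; intros i _.
    destruct (classic (E x y)) as [E_xy|not_E].
    - exists 0; intros k [sep _]; now elim (invariant x y).
    - destruct (not_all_ex_not _ (fun b => exists z, verified x y i b z = true)) as [b b_fails].
      + intros seen; apply not_E, E_iff; eauto.
      + exists (S b); intros k [_ seen]; apply NNPP; intros k_gt; apply b_fails, seen; lia. }
  destruct bounded_depth as [b b_bound]; exists (S b); intros [?|crossing]; [lia|].
  apply b_bound in crossing; lia.
Qed.

Lemma live_depth_unique t u : live live_by t -> live live_by u ->
  cut_of t = cut_of u -> depth_of t = depth_of u.
Proof.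
  rewrite !live_iff; intros [crossed_t not_crossed_t] [crossed_u not_crossed_u] same_cut.
  rewrite same_cut in *.
  destruct (lt_eq_lt_dec (depth_of t) (depth_of u)) as [[depth_lt|]|depth_lt]; [|assumption|].
  - elim not_crossed_t; exact (crossed_antitone _ _ _ depth_lt crossed_u).
  - elim not_crossed_u; exact (crossed_antitone _ _ _ depth_lt crossed_t).
Qed.

Lemma related_bounded x y : E x y -> bounded (differ_live cut_bit live_by x y).
Proof.
  intros E_xy; destruct (related_crosses x y E_xy) as [n0 wide_crossed].
  apply (bounded_incl _ (fun t => exists n, n < n0 /\ exists j, j < length (subsets n) /\
    exists k, t = cpair (cpair n j) k /\ differ_live cut_bit live_by x y t)).
  - intros t [t_live t_sep].
    pose (n := fst (Cantor.of_nat (fst (Cantor.of_nat t)))).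
    pose (j := snd (Cantor.of_nat (fst (Cantor.of_nat t)))).
    assert (t_code : t = cpair (cpair n j) (depth_of t))
      by (unfold n, j, depth_of; now rewrite !cpair_of_nat).
    exists n; split; [|exists j; split; [|exists (depth_of t); repeat split; assumption]].
    + apply Nat.nle_gt; intros n_ge; apply live_iff in t_live as [_ not_crossed].
      now apply not_crossed, wide_crossed.
    + apply Nat.nle_gt; intros j_ge; apply t_sep; unfold cut_bit, cut_of.
      cbn [snd]; now rewrite nth_overflow.
  - apply bounded_union; intros n _; apply bounded_union; intros j _; apply bounded_unique.
    intros t u (k & t_code & t_live & _) (l & u_code & u_live & _).
    rewrite t_code, u_code; f_equal.
    rewrite <- (depth_of_cpair (cpair n j) k), <- t_code.
    rewrite <- (depth_of_cpair (cpair n j) l), <- u_code.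
    apply live_depth_unique; auto; rewrite t_code, u_code, !cut_of_cpair; reflexivity.
Qed.

Lemma unrelated_unbounded x y : ~ E x y -> ~ bounded (differ_live cut_bit live_by x y).
Proof.
  intros not_E [b b_bound].
  pose (n := S (x + y + b)).
  destruct (subsets_complete (E x) n) as (l & l_subset & l_class).
  destruct (In_nth _ _ [] l_subset) as (j & _ & j_index).
  assert (mem_l : forall z, z < n -> (mem z l = true <-> E x z))
    by (intros z z_lt; rewrite mem_In, l_class; tauto).
  destruct (exists_least (fun k => ~ crossed (n, l) k)) as ([|k] & not_crossed & k_least).
  { apply invariant_not_crossed; intros u v u_lt v_lt E_uv sep; apply sep, eq_true_iff_eq.
    cbn [fst snd] in *; rewrite !mem_l by assumption.
    split; intros E_x; [transitivity u|transitivity v]; auto; now symmetry. }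
  { elim not_crossed; now left. }
  pose (t := cpair (cpair n j) k).
  assert (t_cut : cut_of t = (n, l)) by (unfold t; now rewrite cut_of_cpair, j_index).
  assert (t_differs : differ_live cut_bit live_by x y t).
  { split.
    - apply live_iff; rewrite t_cut; unfold t; rewrite depth_of_cpair; split; [|assumption].
      apply NNPP, k_least; lia.
    - unfold cut_bit; rewrite t_cut; cbn [snd]; intros same_side; apply not_E, mem_l; [lia|].
      rewrite <- same_side; apply mem_l; [lia|reflexivity]. }
  apply b_bound in t_differs.
  pose proof (cpair_ge_l (cpair n j) k); pose proof (cpair_ge_l n j); lia.
Qed.
End CrossedCuts.

Lemma Sigma03_limit_normal_form E : Equivalence E -> Sigma03 E ->
  exists bit guess, effective2 bit /\ effective2 guess /\
    (forall t, exists b, converges_to (guess t) b) /\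
    forall x y, E x y <-> bounded (differ_live bit guess x y).
Proof.
  intros E_equivalence (A & A_computable & E_A).
  destruct (effective_of_computable_set A A_computable) as (a & eff_a & a_A).
  assert (E_iff : forall x y, E x y <-> exists i, forall b, exists z, verified a x y i b z = true)
    by (intros x y; rewrite E_A; unfold verified; setoid_rewrite a_A; reflexivity).
  exists cut_bit, (live_by a); repeat split.
  - apply effective_cut_bit.
  - now apply effective_live_by.
  - intros t; destruct (live_by_converges a t) as (b & b_lim & _); eauto.
  - now apply related_bounded.
  - intros bounded_differ; apply NNPP; intros not_E.
    now apply (unrelated_unbounded E a E_equivalence E_iff x y).
Qed.

(** * Finite approximations to a set of numbers *)

(* The decided numbers, and those of them that belong to the set. *)
Definition approximation : Type := list nat * list nat.
Definition decided (p : approximation) : list nat := fst p.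
Definition members (p : approximation) : list nat := snd p.
#[export] Hint Unfold decided members : effective.

Definition consistent (p : approximation) : Prop := incl (members p) (decided p).

Definition extends (p p' : approximation) : Prop :=
  incl (decided p) (decided p') /\
  forall x, In x (decided p) -> (In x (members p') <-> In x (members p)).

Lemma extends_refl p : extends p p.
Proof. split; [apply incl_refl|reflexivity]. Qed.

Lemma extends_trans p q r : extends p q -> extends q r -> extends p r.
Proof.
  intros [decided_pq members_pq] [decided_qr members_qr]; split.
  - now apply incl_tran with (decided q).
  - intros x x_in; rewrite members_qr, members_pq; auto; reflexivity.
Qed.

Lemma extends_members p p' : consistent p -> extends p p' -> incl (members p) (members p').
Proof. intros p_consistent [_ same_members] x x_in; apply same_members; auto. Qed.

Section Construction.
Variable G : computable_subgroup_Sinf.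
Hypothesis G_non_isolated : non_isolated G.
Variables bit guess : nat -> nat -> bool.

Definition separated (d k : nat) (p : approximation) : Prop :=
  exists q q', In q (decided p) /\ In q' (decided p) /\ perm G d q' = perm G k q /\
    (In q (members p) <-> ~ In q' (members p)).

Lemma separated_extends d k g p p' :
  separated d k p -> extends p p' -> fixes G (decided p) g -> separated d (gmul G k g) p'.
Proof.
  intros (q & q' & q_in & q'_in & dq'_kq & split_q) [decided_incl same_members] fix_g.
  exists q, q'; repeat split; auto.
  - now rewrite perm_gmul, fix_g.
  - rewrite !same_members by assumption; apply split_q.
  - rewrite !same_members by assumption; apply split_q.
Qed.

(* Replaces [k] by [k g] with [g] fixing the decided numbers, and decides a new number [q] in such
   a way that exactly one of [q] and [d^-1 k g q] is a member. *)
Definition separate (d : nat) (kp : nat * approximation) : nat * approximation :=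
  let p := snd kp in
  let w := distinguisher G (fst kp) d (decided p) in
  let k := gmul G (fst kp) (fst w) in
  let q' := perm G (ginv G d) (perm G k (snd w)) in
  (k, (snd w :: q' :: decided p, if mem q' (members p) then members p else snd w :: members p)).

Definition separate_all (D : list nat) (p : approximation) : nat * approximation :=
  fold_right separate (one G, p) D.

Lemma separate_consistent d kp : consistent (snd kp) -> consistent (snd (separate d kp)).
Proof.
  intros p_consistent x; cbn; destruct mem; cbn; [auto|intros [<-|x_in]]; auto.
Qed.

Lemma separate_extends d kp : extends (snd kp) (snd (separate d kp)).
Proof.
  destruct (distinguisher_spec G G_non_isolated (fst kp) d (decided (snd kp))) as (_ & q_new & _).
  split; [intros x x_in; cbn; auto|].
  intros x x_in; cbn; destruct mem; [reflexivity|]; cbn; split; auto.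
  intros [<-|]; [contradiction|assumption].
Qed.

Lemma separate_separated d kp : consistent (snd kp) ->
  separated d (fst (separate d kp)) (snd (separate d kp)).
Proof.
  destruct kp as [k p]; unfold separate; cbn [fst snd]; intros p_consistent.
  destruct (distinguisher_spec G G_non_isolated k d (decided p)) as (_ & q_new & kgq_neq_dq).
  destruct (distinguisher G k d (decided p)) as [g q]; cbn [fst snd] in *.
  set (q' := perm G (ginv G d) (perm G (gmul G k g) q)).
  assert (dq'_kgq : perm G d q' = perm G (gmul G k g) q) by apply perm_ginv_r.
  assert (q_neq_q' : q <> q') by (intros <-; rewrite perm_gmul in dq'_kgq; congruence).
  exists q, q'; repeat split; [simpl; auto..|assumption| |]; unfold members; cbn [snd];
    generalize (mem_In q' (snd p)); destruct mem; intros q'_member.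
  - intros q_member; elim q_new; now apply p_consistent.
  - intros _ [?|q'_in]; [contradiction|]; apply q'_member in q'_in; discriminate.
  - intros q'_out; elim q'_out; now apply q'_member.
  - simpl; auto.
Qed.

Lemma separate_all_consistent D p : consistent p -> consistent (snd (separate_all D p)).
Proof. intros p_consistent; induction D; [assumption|now apply separate_consistent]. Qed.

Lemma separate_all_extends D p : extends p (snd (separate_all D p)).
Proof.
  induction D; [apply extends_refl|].
  eapply extends_trans; [exact IHD|apply separate_extends].
Qed.

Lemma separate_all_fixes D p : fixes G (decided p) (fst (separate_all D p)).
Proof.
  induction D as [|d D IH]; [apply fixes_one|]; apply fixes_gmul; [assumption|].
  eapply fixes_incl; [apply (separate_all_extends D)|].
  now apply distinguisher_spec.
Qed.

Lemma separate_all_separated D p d : consistent p -> In d D ->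
  separated d (fst (separate_all D p)) (snd (separate_all D p)).
Proof.
  intros p_consistent d_in; induction D as [|d' D IH]; [contradiction|].
  destruct d_in as [->|d_in].
  - now apply separate_separated, separate_all_consistent.
  - apply (separated_extends d _ _ (snd (separate_all D p))); [auto|apply separate_extends|].
    now apply distinguisher_spec.
Qed.

(** * The finite-injury construction *)

(* The position [t], the guess whether [t] is live, and the group element [h_t]. *)
Definition entry : Type := nat * (bool * nat).
Definition position (e : entry) : nat := fst e.
Definition flag (e : entry) : bool := fst (snd e).
Definition factor (e : entry) : nat := snd (snd e).
#[local] Hint Unfold position flag factor : effective.

Definition up_to_date (s : nat) (e : entry) : bool := Bool.eqb (guess (position e) s) (flag e).

Definition partial_product (x : nat) (L : list entry) : nat :=
  fold_right (fun e a => if flag e && bit (position e) x then gmul G (factor e) a else a) (one G) L.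

Definition subproducts (L : list entry) : list nat :=
  fold_right (fun e P => P ++ map (gmul G (factor e)) P) [one G] L.

Definition saturate (L : list entry) (C : list nat) : list nat :=
  flat_map (fun u => map (perm G u) C) (subproducts L).

Definition targets (L : list entry) : list nat :=
  flat_map (fun u => flat_map (fun v =>
    map (fun g => gmul G (ginv G u) (gmul G g v)) (seq 0 (S (length L))))
    (subproducts L)) (subproducts L).

Definition valid_prefix (s : nat) (L : list entry) : list entry :=
  fold_right (fun e K => if up_to_date s e then e :: K else []) [] L.

Lemma partial_product_app x K L z :
  perm G (partial_product x (K ++ L)) z =
  perm G (partial_product x K) (perm G (partial_product x L) z).
Proof.
  induction K as [|e K IH]; simpl; [now rewrite perm_one|].
  destruct (_ && _); rewrite ?perm_gmul, IH; reflexivity.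
Qed.

Lemma partial_product_congr x y L :
  (forall e, In e L -> flag e = true -> bit (position e) x = bit (position e) y) ->
  partial_product x L = partial_product y L.
Proof.
  intros same_bits; induction L as [|e L IH]; simpl in *; [reflexivity|].
  rewrite IH by auto; destruct (flag e) eqn:flag_e; [|reflexivity].
  rewrite (same_bits e) by auto; reflexivity.
Qed.

Lemma partial_product_subproduct x L : In (partial_product x L) (subproducts L).
Proof.
  induction L as [|e L IH]; simpl; auto.
  apply in_or_app; destruct (_ && _); auto using in_map.
Qed.

Definition factors_fix (F : list nat) (L : list entry) : Prop :=
  Forall (fun e => fixes G F (factor e)) L.

Lemma subproduct_fixes F L u : factors_fix F L -> In u (subproducts L) -> fixes G F u.
Proof.
  intros fix_L; revert u; induction fix_L as [|e L fix_e _ IH]; simpl; intros u u_in.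
  - destruct u_in as [<-|[]]; apply fixes_one.
  - apply in_app_or in u_in as [u_in|(v & <- & v_in)%in_map_iff]; [auto|].
    apply fixes_gmul; auto.
Qed.

Lemma partial_product_fixes F x L : factors_fix F L -> fixes G F (partial_product x L).
Proof. intros fix_L; eapply subproduct_fixes, partial_product_subproduct; exact fix_L. Qed.

Lemma in_saturate x L C c : In c C -> In (perm G (partial_product x L) c) (saturate L C).
Proof.
  intros c_in; apply in_flat_map; exists (partial_product x L).
  split; [apply partial_product_subproduct|now apply in_map].
Qed.

Lemma saturate_fixed F L C c :
  factors_fix F L -> In c F -> (In c (saturate L C) <-> In c C).
Proof.
  intros fix_L c_in; split.
  - intros (u & u_in & (b & <- & b_in)%in_map_iff)%in_flat_map.
    now rewrite (fixes_preimage G F u) by eauto using subproduct_fixes.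
  - intros c_member; rewrite <- (partial_product_fixes F 0 L fix_L c c_in).
    now apply in_saturate.
Qed.

Lemma in_targets L u v g :
  In u (subproducts L) -> In v (subproducts L) -> g <= length L ->
  In (gmul G (ginv G u) (gmul G g v)) (targets L).
Proof.
  intros u_in v_in g_le; apply in_flat_map; exists u; split; [assumption|].
  apply in_flat_map; exists v; split; [assumption|].
  apply (in_map (fun g => gmul G (ginv G u) (gmul G g v))), in_seq; lia.
Qed.

Lemma valid_prefix_skipn s L : valid_prefix s L ++ skipn (length (valid_prefix s L)) L = L.
Proof. induction L; simpl; [|destruct up_to_date; simpl; rewrite ?IHL]; reflexivity. Qed.

Lemma valid_prefix_up_to_date s L e : In e (valid_prefix s L) -> up_to_date s e = true.
Proof.
  induction L as [|e' L IH]; simpl; [contradiction|].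
  destruct (up_to_date s e') eqn:up_e'; simpl; [intros [<-|]; auto|contradiction].
Qed.

Lemma valid_prefix_app s K L :
  (forall e, In e K -> up_to_date s e = true) ->
  valid_prefix s (K ++ L) = K ++ valid_prefix s L.
Proof.
  intros up_K; induction K as [|e K IH]; simpl in *; [reflexivity|].
  now rewrite up_K, IH by auto.
Qed.

Definition step (s : nat) (state : list entry * approximation) : list entry * approximation :=
  let K := valid_prefix s (fst state) in
  let C := saturate (skipn (length K) (fst state)) (members (snd state)) in
  let kp := separate_all (targets K) (decided (snd state) ++ C, C) in
  (K ++ [(length K, (guess (length K) s, fst kp))], snd kp).

Definition run (s : nat) : list entry * approximation :=
  nat_rect (fun _ => (list entry * approximation)%type) ([], ([], []))
    (fun n state => step (S n) state) s.

Definition entries (s : nat) : list entry := fst (run s).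
Definition approx (s : nat) : approximation := snd (run s).

Definition stage_set (x s : nat) : list nat :=
  map (perm G (partial_product x (entries s))) (members (approx s)).

Definition limit_set (x z : nat) : Prop := exists s, In z (stage_set x s).

Definition kept (s : nat) : list entry := valid_prefix (S s) (entries s).
Definition dropped (s : nat) : list entry := skipn (length (kept s)) (entries s).

Definition saturated (s : nat) : approximation :=
  let C := saturate (dropped s) (members (approx s)) in (decided (approx s) ++ C, C).

Definition new_factor (s : nat) : nat := fst (separate_all (targets (kept s)) (saturated s)).

Lemma entries_S s :
  entries (S s) = kept s ++ [(length (kept s), (guess (length (kept s)) (S s), new_factor s))].
Proof. reflexivity. Qed.

Lemma kept_dropped s : kept s ++ dropped s = entries s.
Proof. apply valid_prefix_skipn. Qed.

Lemma saturated_consistent s : consistent (saturated s).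
Proof. apply incl_appr, incl_refl. Qed.

Lemma saturated_extended s : extends (saturated s) (approx (S s)).
Proof. apply separate_all_extends. Qed.

Lemma new_factor_fixes s : fixes G (decided (saturated s)) (new_factor s).
Proof. apply separate_all_fixes. Qed.

Lemma new_factor_separated s d : In d (targets (kept s)) ->
  separated d (new_factor s) (approx (S s)).
Proof. apply separate_all_separated, saturated_consistent. Qed.

Lemma stage_set_S x s : incl (stage_set x s) (stage_set x (S s)).
Proof.
  intros z (c & <- & c_in)%in_map_iff.
  pose (c' := perm G (partial_product x (dropped s)) c).
  assert (c'_in : In c' (members (saturated s))) by now apply in_saturate.
  apply in_map_iff; exists c'; split.
  - rewrite entries_S, <- (kept_dropped s), !partial_product_app; f_equal.
    apply (partial_product_fixes (decided (saturated s))).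
    + repeat constructor; apply new_factor_fixes.
    + now apply saturated_consistent.
  - apply (extends_members (saturated s)); auto using saturated_consistent, saturated_extended.
Qed.

Lemma stage_set_mono x s s' : s <= s' -> incl (stage_set x s) (stage_set x s').
Proof.
  induction 1 as [|s' _ IH]; [apply incl_refl|apply (incl_tran IH), stage_set_S].
Qed.

Lemma entries_up_to_date s e : In e (entries s) -> up_to_date s e = true.
Proof.
  destruct s as [|s]; [contradiction|]; rewrite entries_S.
  intros [e_in|[<-|[]]]%in_app_or; [now apply valid_prefix_up_to_date in e_in|].
  apply eqb_reflx.
Qed.

Lemma entries_position s : map position (entries s) = seq 0 (length (entries s)).
Proof.
  induction s as [|s IH]; [reflexivity|].
  rewrite <- kept_dropped in IH; apply map_app_eq_seq in IH as [IH _].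
  rewrite entries_S; apply map_app_eq_seq; auto.
Qed.

Definition true_stage (s : nat) : Prop :=
  forall s' e, s <= s' -> In e (entries s) -> up_to_date s' e = true.

Lemma true_stage_flag s e :
  true_stage s -> In e (entries s) -> converges_to (guess (position e)) (flag e).
Proof. intros s_true e_in; exists s; intros s' s'_ge; now apply eqb_prop, s_true. Qed.

Lemma kept_app s K R : (forall e, In e K -> up_to_date (S s) e = true) -> entries s = K ++ R ->
  kept s = K ++ valid_prefix (S s) R /\ dropped s = skipn (length (valid_prefix (S s) R)) R.
Proof.
  intros up_K entries_s; unfold dropped, kept; rewrite entries_s, valid_prefix_app by assumption.
  split; [reflexivity|].
  rewrite length_app, skipn_app, skipn_all2 by lia; simpl; f_equal; lia.
Qed.

Lemma true_stage_tail s s' : true_stage s -> s <= s' ->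
  exists R, entries s' = entries s ++ R /\
    factors_fix (decided (approx s)) R /\
    extends (approx s) (approx s').
Proof.
  intros s_true s_le; induction s_le as [|s' s_le (R & entries_s' & fix_R & extended)].
  { exists []; rewrite app_nil_r; split; [reflexivity|split; [constructor|apply extends_refl]]. }
  destruct (kept_app s' (entries s) R) as [kept_s' dropped_s']; [auto|assumption|].
  rewrite <- (valid_prefix_skipn (S s') R), <- dropped_s' in fix_R.
  apply Forall_app in fix_R as [fix_valid fix_dropped].
  assert (extended_saturated : extends (approx s) (saturated s')).
  { split; [apply incl_appl, extended|]; intros x x_in; unfold saturated, members at 1; cbn [snd].
    rewrite (saturate_fixed _ _ _ _ fix_dropped x_in); now apply extended. }
  eexists; rewrite entries_S, kept_s', <- app_assoc; split; [reflexivity|]; split.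
  - apply Forall_app; split; [exact fix_valid|]; repeat constructor.
    exact (fixes_incl _ _ _ _ (proj1 extended_saturated) (new_factor_fixes s')).
  - exact (extends_trans _ _ _ extended_saturated (saturated_extended s')).
Qed.

Lemma true_stage_decides x s p : true_stage s -> In p (decided (approx s)) ->
  limit_set x (perm G (partial_product x (entries s)) p) <-> In p (members (approx s)).
Proof.
  intros s_true p_in; split; [|intros p_member; exists s; now apply in_map].
  intros [s' in_s']; apply (stage_set_mono x s' (max s s')) in in_s'; [|lia].
  destruct (true_stage_tail s (max s s')) as (R & entries_max & fix_R & _ & same_members);
    [assumption|lia|].
  apply same_members; [assumption|].
  unfold stage_set in in_s'; rewrite entries_max in in_s'.
  apply in_map_iff in in_s' as (c & c_p & c_in); rewrite partial_product_app in c_p.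
  apply perm_inj in c_p; rewrite <- (partial_product_fixes _ x R fix_R p p_in) in c_p.
  now apply perm_inj in c_p; subst c.
Qed.

Hypothesis guess_converges : forall t, exists b, converges_to (guess t) b.

Lemma entries_S_reset s u (t := length (entries s)) :
  true_stage s -> s <= u -> u = s \/ guess t (S u) <> guess t u ->
  entries (S u) = entries s ++ [(t, (guess t (S u), new_factor u))].
Proof.
  intros s_true s_le reset.
  destruct (true_stage_tail s u s_true s_le) as (R & entries_u & _).
  destruct (kept_app u (entries s) R) as [kept_u _]; [auto|assumption|].
  rewrite entries_S, kept_u.
  enough (valid_prefix (S u) R = []) as -> by now rewrite app_nil_r.
  destruct R as [|e R]; [reflexivity|]; simpl.
  destruct reset as [->|changed].
  { apply (f_equal (@length entry)) in entries_u; rewrite length_app in entries_u.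
    simpl in entries_u; lia. }
  assert (e_position : position e = t).
  { pose proof (entries_position u) as positions; rewrite entries_u in positions.
    apply map_app_eq_seq in positions as [_ positions]; now injection positions. }
  assert (e_flag : guess t u = flag e).
  { rewrite <- e_position; apply eqb_prop, entries_up_to_date; rewrite entries_u; apply in_elt. }
  destruct (up_to_date (S u) e) eqn:e_valid; [exfalso|reflexivity].
  apply eqb_prop in e_valid; congruence.
Qed.

(* The next true stage is the least stage from which on the guess about the position after
   [entries s] is constant. *)
Lemma true_stage_next s : true_stage s ->
  exists u e, s < u /\ true_stage u /\ entries u = entries s ++ [e].
Proof.
  intros s_true; pose (t := length (entries s)).
  destruct (exists_least (fun u => s < u /\ forall v, u <= v -> guess t v = guess t u))
    as (u & [s_lt stable] & u_least).
  { destruct (guess_converges t) as (b & w & limit); exists (S (max s w)); split; [lia|].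
    intros v v_ge; rewrite !limit by lia; reflexivity. }
  destruct u as [|u]; [lia|].
  assert (entries_u : entries (S u) = entries s ++ [(t, (guess t (S u), new_factor u))]).
  { apply entries_S_reset; [assumption|lia|].
    destruct (Nat.eq_dec u s) as [|u_neq]; [now left|right]; intros unchanged.
    apply (u_least u); [lia|]; split; [lia|]; intros v v_ge.
    destruct (Nat.eq_dec v u) as [->|v_neq]; [reflexivity|]; rewrite stable by lia; assumption. }
  exists (S u); eexists; split; [assumption|]; split; [|exact entries_u].
  intros v e v_ge; rewrite entries_u; intros [e_in|[<-|[]]]%in_app_or.
  - apply s_true; auto; lia.
  - apply eqb_true_iff; now apply stable.
Qed.

Lemma true_stage_exists m : exists s, m <= s /\ true_stage s /\ length (entries s) = m.
Proof.
  induction m as [|m (s & s_ge & s_true & length_s)].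
  { exists 0; repeat split; auto; intros s' e _ []. }
  destruct (true_stage_next s s_true) as (u & e & s_lt & u_true & entries_u).
  exists u; repeat split; [lia|assumption|rewrite entries_u, length_app; simpl; lia].
Qed.

Lemma live_true_stage t : live guess t ->
  exists s (K : list entry) h, true_stage s /\ length K = t /\ entries s = K ++ [(t, (true, h))].
Proof.
  intros t_live; destruct (true_stage_exists (S t)) as (s & _ & s_true & length_s).
  destruct (exists_last (l := entries s)) as (K & (t' & b & h) & entries_s);
    [intros empty; now rewrite empty in length_s|].
  rewrite entries_s, length_app in length_s; simpl in length_s.
  assert (t' = t) as ->.
  { pose proof (entries_position s) as positions; rewrite entries_s in positions.
    apply map_app_eq_seq in positions as [_ positions]; injection positions; cbn; lia. }
  assert (b = true) as ->.
  { apply (converges_to_unique (guess t)); [|assumption].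
    apply (true_stage_flag s (t, (b, h)) s_true); rewrite entries_s; apply in_elt. }
  exists s, K, h; repeat split; [assumption|lia|assumption].
Qed.

Lemma last_factor_separated s K e g x y :
  entries s = K ++ [e] -> g <= length K ->
  separated (gmul G (ginv G (partial_product x K)) (gmul G g (partial_product y K)))
    (factor e) (approx s).
Proof.
  destruct s as [|s]; [destruct K; discriminate|].
  rewrite entries_S; intros [<- <-]%app_inj_tail g_le.
  apply new_factor_separated, in_targets; auto using partial_product_subproduct.
Qed.

Lemma last_factor_diagonalizes s (K : list entry) t h g x y :
  true_stage s -> entries s = K ++ [(t, (true, h))] -> g <= length K ->
  bit t x = true -> bit t y = false -> ~ carries G g (limit_set y) (limit_set x).
Proof.
  intros s_true entries_s g_le bit_x bit_y g_yx.
  destruct (last_factor_separated s K _ g x y entries_s g_le)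
    as (q & q' & q_in & q'_in & same_image & split_q).
  rewrite !perm_gmul in same_image; cbn in same_image.
  assert (x_image : perm G (partial_product x (entries s)) q =
                    perm G (partial_product x K) (perm G h q)).
  { rewrite entries_s, partial_product_app; cbn; rewrite bit_x; cbn.
    now rewrite perm_gmul, perm_one. }
  assert (y_image : perm G (partial_product y (entries s)) q' = perm G (partial_product y K) q').
  { rewrite entries_s, partial_product_app; cbn; rewrite bit_y; cbn; now rewrite perm_one. }
  assert (g_image : perm G (partial_product x (entries s)) q =
                    perm G g (perm G (partial_product y (entries s)) q')).
  { rewrite x_image, y_image, <- same_image; apply perm_ginv_r. }
  pose proof (true_stage_decides x s q s_true q_in) as decides_q.
  pose proof (true_stage_decides y s q' s_true q'_in) as decides_q'.
  rewrite g_image, (g_yx _) in decides_q; tauto.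
Qed.

Lemma carries_bounded g x y :
  carries G g (limit_set y) (limit_set x) -> bounded (differ_live bit guess x y).
Proof.
  intros g_yx; exists (S (g + ginv G g)); intros t [t_live bits_differ].
  apply Nat.nle_gt; intros t_ge.
  destruct (live_true_stage t t_live) as (s & K & h & s_true & length_K & entries_s).
  destruct (bit t x) eqn:bit_x, (bit t y) eqn:bit_y; try congruence.
  - apply (last_factor_diagonalizes s K t h g x y); auto; lia.
  - apply (last_factor_diagonalizes s K t h (ginv G g) y x); auto using carries_ginv; lia.
Qed.

Lemma bounded_tail s s' x y :
  true_stage s -> (forall t, differ_live bit guess x y t -> t < length (entries s)) ->
  true_stage s' -> s <= s' ->
  exists R, entries s' = entries s ++ R /\ partial_product x R = partial_product y R.
Proof.
  intros s_true differ_lt s'_true s_le.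
  destruct (true_stage_tail s s' s_true s_le) as (R & entries_s' & _).
  exists R; split; [assumption|]; apply partial_product_congr; intros e e_in flag_e.
  apply NNPP; intros bits_differ.
  assert (e_live : live guess (position e)).
  { unfold live; rewrite <- flag_e; apply (true_stage_flag s'); [assumption|].
    rewrite entries_s'; apply in_or_app; auto. }
  pose proof (differ_lt _ (conj e_live bits_differ)) as position_lt.
  pose proof (entries_position s') as positions; rewrite entries_s' in positions.
  apply map_app_eq_seq in positions as [_ positions].
  apply (in_map position) in e_in; rewrite positions in e_in; apply in_seq in e_in; lia.
Qed.

Lemma limit_set_true_stage s x z :
  limit_set x z <-> exists s', s <= s' /\ true_stage s' /\ In z (stage_set x s').
Proof.
  split; [|intros (s' & _ & _ & z_in); now exists s'].
  intros [u z_in]; destruct (true_stage_exists (max s u)) as (s' & s'_ge & s'_true & _).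
  exists s'; repeat split; [lia|assumption|].
  apply (stage_set_mono x u s'); [lia|assumption].
Qed.

Lemma bounded_carries x y : bounded (differ_live bit guess x y) ->
  exists g, carries G g (limit_set y) (limit_set x).
Proof.
  intros [b b_bound]; destruct (true_stage_exists b) as (s & _ & s_true & length_s).
  rewrite <- length_s in b_bound.
  exists (gmul G (partial_product x (entries s)) (ginv G (partial_product y (entries s)))).
  intros z; rewrite perm_gmul; rewrite <- (perm_ginv_r G (partial_product y (entries s)) z) at 2.
  generalize (perm G (ginv G (partial_product y (entries s))) z); clear z; intros z.
  rewrite !(limit_set_true_stage s).
  enough (same_stage : forall s', s <= s' -> true_stage s' ->
    In (perm G (partial_product x (entries s)) z) (stage_set x s') <->
    In (perm G (partial_product y (entries s)) z) (stage_set y s'))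
    by (split; intros (s' & s'_ge & s'_true & z_in); exists s'; apply same_stage in z_in; auto).
  intros s' s'_ge s'_true.
  destruct (bounded_tail s s' x y) as (R & entries_s' & same_tail); auto.
  unfold stage_set; rewrite entries_s', !in_map_iff; setoid_rewrite partial_product_app.
  split; intros (c & c_z & c_in); exists c; split; auto; apply perm_inj in c_z; congruence.
Qed.

Hypothesis effective_bit : effective2 bit.
Hypothesis effective_guess : effective2 guess.

#[local] Hint Resolve effective_perm effective_gmul effective_ginv effective_distinguisher
  : effective.

Lemma effective_step : effective2 step.
Proof.
  assert (effective2 valid_prefix) by (unfold valid_prefix, up_to_date; effectivity).
  assert (effective subproducts) by (unfold subproducts; effectivity).
  assert (effective2 saturate) by (unfold saturate; effectivity).
  assert (effective targets) by (unfold targets; effectivity).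
  assert (effective2 separate) by (unfold separate; effectivity).
  assert (effective2 separate_all) by (unfold separate_all; effectivity).
  unfold step; effectivity.
Qed.

Lemma effective_stage_set : effective2 stage_set.
Proof.
  pose proof effective_step.
  assert (effective run) by (unfold run; effectivity).
  assert (effective2 partial_product) by (unfold partial_product; effectivity).
  unfold stage_set, entries, approx; effectivity.
Qed.

Lemma limit_set_family : exists f, computable f /\
  forall x y, Rce G (f x) (f y) <-> bounded (differ_live bit guess x y).
Proof.
  destruct (ce_sets_index (fun x z s => mem z (stage_set x s))) as (f & f_computable & W_f).
  { pose proof effective_stage_set; effectivity. }
  assert (W_limit : forall x z, W (f x) z <-> limit_set x z)
    by (intros x z; rewrite W_f; unfold limit_set; setoid_rewrite mem_In; reflexivity).
  exists f; split; [assumption|]; intros x y.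
  rewrite Rce_iff_carries; unfold carries; setoid_rewrite W_limit; split.
  - intros [g g_yx]; exact (carries_bounded g x y g_yx).
  - apply bounded_carries.
Qed.
End Construction.

(** * Universality *)

Theorem theorem3p15 (G : computable_subgroup_Sinf) :
  non_isolated G -> Sigma03_universal (Rce G).
Proof.
  intros G_non_isolated E E_equivalence E_Sigma03.
  destruct (Sigma03_limit_normal_form E E_equivalence E_Sigma03)
    as (bit & guess & effective_bit & effective_guess & guess_converges & E_iff).
  destruct (limit_set_family G G_non_isolated bit guess guess_converges
    effective_bit effective_guess) as (f & f_computable & Rce_f).
  exists f; split; [assumption|]; intros x y.
  now rewrite E_iff, Rce_f.
Qed.
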